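(* Fix $d_1,d_2\in\mathbb{N}$. Let $\mathcal{C}$ be the class of all random matrices $X$, of arbitrary dimensions $n\times m$ ($n,m\in\mathbb{N}$), with entries $X_{ij}=b_{ij}\xi_{ij}$, where $b_{ij}\ge 0$ are scalars and $\xi_{ij}$ ($i\le n$, $j\le m$) are independent, symmetrically distributed real random variables with $\mathbf{E}[\xi_{ij}^{2p}]\le \mathbf{E}[g^{2p}]$ for all $i,j$ and all $p\in\mathbb{N}$ (here $g\sim N(0,1)$), such that $$\max_{i\le n,\,j\le m} b_{ij}^2=1,\qquad \max_{j\le m}\sum_{i\le n} b_{ij}^2\le d_1,\qquad \max_{i\le n}\sum_{j\le m} b_{ij}^2\le d_2.$$ Then among all $X\in\mathcal{C}$, the normalized moments $\mathbf{E}[\mathrm{tr}\,(XX^* )^p]$ are maximized, simultaneously for all $p\in\mathbb{N}$, by the $d_1\times d_2$ matrix $Y$ with i.i.d. $N(0,1)$ entries. That is, $Y\in\mathcal{C}$ and $$\mathbf{E}[\mathrm{tr}\,(XX^* )^p]\le \mathbf{E}[\mathrm{tr}\,(YY^* )^p]\quad\text{for all }X\in\mathcal{C},\ p\in\mathbb{N}.$$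
   Context: For a $k\times k$ matrix $M$, $\mathrm{tr}\,M:=\frac1k\sum_{i=1}^k M_{ii}$ denotes the normalized trace (so each matrix is normalized by its own dimension: $n$ for $XX^*$, $d_1$ for $YY^*$). $M^*$ denotes the adjoint. ''Symmetrically distributed'' means that $\xi_{ij}$ and $-\xi_{ij}$ have the same law. *)

(* Defs.v *)
From HB Require Import structures.
From mathcomp Require Import all_boot all_order all_algebra.
From mathcomp Require Import all_classical all_reals all_analysis.

Set Implicit Arguments.
Unset Strict Implicit.
Unset Printing Implicit Defensive.

Import Order.TTheory GRing.Theory Num.Theory.
Import numFieldNormedType.Exports.

Local Open Scope classical_set_scope.
Local Open Scope ring_scope.

Section RandomVariables.
Context {d : measure_display} {T : measurableType d} {R : realType}.
Variable P : probability T R.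

Definition mutually_independent (I : finType) (X : I -> {RV P >-> R}) : Prop :=
  forall (J : {set I}) (A : I -> set R),
    (forall i, i \in J -> measurable (A i)) ->
    P (\bigcap_(i in [set` J]) (X i @^-1` A i)) =
      (\prod_(i in J) P (X i @^-1` A i))%E.

(* Equality of laws is only asked on Borel sets: [distribution P X] is a
   function on all subsets of [R], with no meaning outside the Borel sets. *)
Definition symmetrically_distributed (X : {RV P >-> R}) : Prop :=
  forall A : set R, measurable A ->
    distribution P X A = P ((fun w => - X w) @^-1` A).

(* The second parameter of [normal_prob] is the standard deviation. *)
Definition standard_gaussian (X : {RV P >-> R}) : Prop :=
  forall A : set R, measurable A -> distribution P X A = normal_prob 0 1 A.

End RandomVariables.

Definition normalized_trace {R : realType} (k : nat) (M : 'M[R]_k) : R :=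
  k%:R^-1 * \tr M.

Section RandomMatrices.
Context {d : measure_display} {T : measurableType d} {R : realType}.
Variable P : probability T R.

(* Entries are real, so the adjoint is the transpose. *)
Definition normalized_moment (n m : nat) (X : T -> 'M[R]_(n, m)) (p : nat) :
    \bar R :=
  ('E_P[(fun w => normalized_trace ((X w *m (X w)^T) ^+ p))%R])%E.

(* The maxima are over nonnegative quantities, so the default value 0 only
   matters for empty matrices, which the constraint [... = 1] excludes. *)
Definition sparse_class (d1 d2 n m : nat) (X : T -> 'M[R]_(n, m)) : Prop :=
  exists (b : 'M[R]_(n, m)) (xi : 'I_n -> 'I_m -> {RV P >-> R}),
    [/\ forall w i j, X w i j = b i j * xi i j w,
        forall i j, 0 <= b i j,
        mutually_independent (fun ij : 'I_n * 'I_m => xi ij.1 ij.2),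
        forall i j, symmetrically_distributed (xi i j) &
        forall i j (p : nat),
          ('E_P[(fun w => (xi i j w) ^+ (2 * p))%R] <=
             'E_(normal_prob 0 1)[(fun x : R => x ^+ (2 * p))%R])%E] /\
    [/\ \big[Num.max/0]_(i < n) \big[Num.max/0]_(j < m) b i j ^+ 2 = 1,
        \big[Num.max/0]_(j < m) \sum_(i < n) b i j ^+ 2 <= d1%:R &
        \big[Num.max/0]_(i < n) \sum_(j < m) b i j ^+ 2 <= d2%:R].

Definition iid_standard_gaussian_matrix (n m : nat) (Y : T -> 'M[R]_(n, m)) :
    Prop :=
  exists g : 'I_n -> 'I_m -> {RV P >-> R},
    [/\ forall w i j, Y w i j = g i j w,
        mutually_independent (fun ij : 'I_n * 'I_m => g ij.1 ij.2) &
        forall i j, standard_gaussian (g i j)].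

End RandomMatrices.

(* Main.v *)
Require Import Defs.
From HB Require Import structures.
From mathcomp Require Import all_boot all_order all_algebra.
From mathcomp Require Import all_classical all_reals all_analysis.
From mathcomp Require Import measurable_realfun ring lra.

Set Implicit Arguments.
Unset Strict Implicit.
Unset Printing Implicit Defensive.

Import Order.TTheory GRing.Theory Num.Theory.
Import numFieldNormedType.Exports.

(** Write [X = (b_ij xi_ij)].  The trace of [(X X^T)^p] is a sum over closed
    walks [i_0 j_0 i_1 j_1 ... i_0] of length [2p] between rows and columns
    ([trace_gram_power]), and by independence ([integral_prod_indep]) the
    expectation of the term of a walk is the product over its edges [e] of
    [b_e ^ k_e E[xi_e ^ k_e]], where [k_e] counts the visits to [e].  All
    these terms are nonnegative: symmetry kills the odd moments.  So the
    moments of [xi_e] may be replaced by the larger Gaussian ones, with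
    equality for [Y], and the statement becomes an inequality between two
    explicit finite sums ([gaussian_domination]).

    By Wick's formula ([wick]) the product of Gaussian moments counts the
    pairings of the [2p] steps of the walk that only match steps along the
    same edge.  After exchanging the sums it suffices to compare, for each
    fixed pairing [pi], the weighted number of walks compatible with [pi].
    Compatibility with [pi] amounts to prescribing which vertices of the walk
    coincide.  Build such a walk one vertex at a time: a vertex in the class
    of an earlier one is determined, and otherwise it is new and free.  For
    [Y] each new row index has [d1] choices and each new column index [d2]
    choices, exactly.  For [X] the step leading to a new vertex is never
    paired with the step leading to another new vertex, so it brings a weight
    [b_e ^ 2], whose sum over the new vertex is at most [d1] or [d2], and the
    weights of the remaining steps are at most [1]
    ([sum_consistent_words], [prod_edges_le]).  The only difference is the
    starting vertex, with [n] choices for [X] and [d1] for [Y]; the normalized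
    trace divides it out.

    Such a comparison would fail if one compared walks according to the exact
    coincidence pattern of their vertices: it is the sum over pairings, where
    vertices that need not coincide are allowed to, which makes the count for
    [Y] a pure product. *)

(** * Pairings and Wick's formula *)

(** The perfect matchings of a list of [2k] positions, unfolded one pair at a
    time: the first position is matched with any other one.  In a matching of
    an increasing list the smaller end of each pair then comes first. *)
Fixpoint pairings (k : nat) (s : seq nat) : seq (seq (nat * nat)) :=
  match k, s with
  | k'.+1, x :: s' => [seq (x, y) :: pi | y <- s', pi <- pairings k' (rem y s')]
  | k'.+1, [::] => [::]
  | 0, _ => [:: [::]]
  end.

Definition endpoints (pi : seq (nat * nat)) : seq nat :=
  flatten [seq [:: ab.1; ab.2] | ab <- pi].

(** The moments of [N(0,1)]: [(k-1)!!] for even [k] and [0] for odd [k]. *)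
Fixpoint gaussian_moment (k : nat) : nat :=
  match k with 0 => 1 | 1 => 0 | k'.+2 => k'.+1 * gaussian_moment k' end.

Lemma gaussian_momentS c : gaussian_moment c.+1 = c * gaussian_moment c.-1.
Proof. by case: c. Qed.

Lemma gaussian_moment_odd k : odd k -> gaussian_moment k = 0.
Proof.
elim/ltn_ind: k => -[|[|k]] IH //= ok.
by rewrite IH ?muln0 //; rewrite negbK in ok.
Qed.

Lemma perm_endpoints k s pi : size s = k.*2 -> pi \in pairings k s ->
  perm_eq (endpoints pi) s.
Proof.
elim: k s pi => [|k IH] [|x s] //= pi; first by rewrite inE => _ /eqP ->.
move=> [ss] /allpairsPdep [y [pi' [ys pi's ->]]].
rewrite /endpoints /= perm_cons perm_sym.
apply: (perm_trans (perm_to_rem ys)); rewrite perm_cons perm_sym.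
by apply: IH pi's; rewrite size_rem // ss.
Qed.

Lemma pairings_ltn k s pi : sorted ltn s -> pi \in pairings k s ->
  all (fun ab => ab.1 < ab.2) pi.
Proof.
elim: k s pi => [|k IH] [|x s] //= pi.
- by rewrite inE => _ /eqP ->.
- by rewrite inE => _ /eqP ->.
rewrite path_sortedE; last exact: ltn_trans.
move=> /andP[xs ss] /allpairsPdep [y [pi' [ys pi's ->]]] /=.
apply/andP; split; first exact: (allP xs).
apply: IH pi's.
by apply: subseq_sorted ss; [exact: ltn_trans | exact: rem_subseq].
Qed.

(** Both sides satisfy the same recursion.  Matching the first position [x]
    with one of the [c] other positions that carry the label of [x] removes
    two occurrences of this label, which mirrors the recursion
    [E g^(c+1) = c E g^(c-1)]. *)
Lemma wick (E : finType) (lab : nat -> E) k s : size s = k.*2 ->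
  \sum_(pi <- pairings k s) all (fun ab => lab ab.1 == lab ab.2) pi =
  \prod_(e : E) gaussian_moment (count (fun t => lab t == e) s).
Proof.
elim: k s => [|k IH] [|x s] //= ss.
  by rewrite big_seq1 big1.
case: ss => ss.
rewrite big_allpairs_dep /=.
set c := count (fun t => lab t == lab x) s.
set Q := \prod_(e | e != lab x) gaussian_moment (count (fun t => lab t == e) s).
transitivity (\sum_(y <- s) (lab y == lab x) * (gaussian_moment c.-1 * Q)).
  rewrite big_seq [RHS]big_seq; apply: eq_bigr => y ys.
  rewrite eq_sym; have [exy|] /= := eqVneq (lab x) (lab y); last first.
    by rewrite big1.
  rewrite IH ?size_rem ?ss // mul1n (bigD1 (lab x)) //=; congr (_ * _).
    by rewrite count_rem ys exy eqxx subn1 /c exy.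
  apply: eq_bigr => e; rewrite eq_sym => ne; rewrite count_rem.
  by rewrite -exy (negbTE ne) andbF subn0.
rewrite -big_distrl /= -big_mkcond_idem //=.
rewrite (bigD1 (lab x)) //= eqxx add1n -/c gaussian_momentS mulnA.
congr (_ * _ * _); first by rewrite sum1_count.
by apply: eq_bigr => e; rewrite eq_sym => /negbTE ->.
Qed.

(** * Coincidences between positions *)

(** Merging the classes of [x] and [y] redirects the larger of their two
    representatives to the smaller one, so that every position is represented
    by the least element of its class.  The last clause says that satisfying
    the equations of [C] is the same as being a function of the class. *)
Lemma union_find (C : seq (nat * nat)) (N : nat) :
  all (fun xy => [&& xy.1 < N, xy.2 < N & odd xy.1 == odd xy.2]) C ->
  exists root : nat -> nat,
    [/\ forall t, root t <= t, forall t, odd (root t) = odd t,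
        forall t, root (root t) = root t,
        forall t, N <= t -> root t = t &
        forall (T : eqType) (s : nat -> T),
          all (fun xy => s xy.1 == s xy.2) C <-> forall t, s t = s (root t)].
Proof.
elim: C => [|[x y] C IH] /=.
  by exists id; split.
case/andP => /and3P[xN yN /eqP oxy] /IH [r [rle rodd ridem rN rP]].
pose hi := maxn (r x) (r y); pose lo := minn (r x) (r y).
exists (fun t => if r t == hi then lo else r t).
have lohi : lo <= hi by rewrite geq_min leq_max leqnn.
have ohi : odd hi = odd lo.
  by rewrite /hi /lo /maxn /minn; case: ifP => _; rewrite !rodd oxy.
have rlo : r lo = lo by rewrite /lo /minn; case: ifP.
have rhi : r hi = hi by rewrite /hi /maxn; case: ifP.
split.
- by move=> t; case: eqP => [h|_] //; apply: leq_trans lohi _; rewrite -h.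
- by move=> t; case: eqP => [h|_] //; rewrite -ohi -h rodd.
- move=> t; have [_|/negbTE h] := eqVneq (r t) hi; last by rewrite ridem h.
  by rewrite rlo; case: ifP.
- move=> t tN; rewrite rN //; case: eqP => // ht.
  suff: hi < N by rewrite -ht ltnNge tN.
  by rewrite gtn_max (leq_ltn_trans (rle _) xN) (leq_ltn_trans (rle _) yN).
- move=> T s; split.
    case/andP => /eqP sxy /rP sr t; case: eqP => [h|_] //.
    have : s hi = s lo.
      by rewrite /hi /lo /maxn /minn; case: ifP => _; rewrite -!sr.
    by move=> <-; rewrite -h.
  move=> sr; have sr0 t : s t = s (r t).
    by rewrite sr [in RHS]sr ridem.
  apply/andP; split; last exact/rP.
  have e : s (r x) = s (r y).
    rewrite sr [in RHS]sr !ridem /hi /lo /maxn /minn.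
    by case: ltnP => _; rewrite eqxx; case: eqP => // ->.
  by rewrite sr0 e -sr0.
Qed.

(** * Words describing bipartite walks *)

Definition alphabet (n m t : nat) : nat := if odd t then m else n.

(** A walk alternating between [n] rows and [m] columns is encoded by the word
    of its vertices, rows at even and columns at odd positions.  Letters are
    natural numbers, so that both kinds of vertices fit in one list. *)
Fixpoint words (n m k : nat) : seq (seq nat) :=
  if k is k'.+1
  then [seq rcons s x | s <- words n m k', x <- iota 0 (alphabet n m k')]
  else [:: [::]].

Lemma big_wordsS (V : nmodType) n m k (F : seq nat -> V) :
  (\sum_(s <- words n m k.+1) F s =
   \sum_(s <- words n m k) \sum_(x <- iota 0 (alphabet n m k)) F (rcons s x))%R.
Proof. by rewrite /= big_allpairs_dep. Qed.

Lemma words_alphabet n m k s : s \in words n m k ->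
  size s = k /\ forall t, t < k -> nth 0 s t < alphabet n m t.
Proof.
elim: k s => [|k IH] s; first by rewrite inE => /eqP ->.
case/allpairsPdep => s' [x [/IH [ss' ws'] xk ->]].
rewrite mem_iota add0n /= in xk.
rewrite size_rcons ss'; split=> // t; rewrite ltnS nth_rcons ss' => tk.
by move: tk; case: (ltngtP t k) => [tk _|//|-> _] //; exact: ws'.
Qed.

Lemma count_iota_eq1 N y : y < N -> \sum_(x <- iota 0 N | x == y) 1 = 1.
Proof.
move=> yN; rewrite sum1_count (count_uniq_mem y (iota_uniq 0 N)).
by rewrite mem_iota yN.
Qed.

Section Consistent.
(* [root] picks a representative of each class of positions that are required
   to carry the same letter; the positions it fixes are the new vertices. *)
Variable root : nat -> nat.
Hypothesis root_le : forall t, root t <= t.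
Hypothesis root_odd : forall t, odd (root t) = odd t.

Definition consistent (s : seq nat) : bool :=
  all (fun t => nth 0 s t == nth 0 s (root t)) (iota 0 (size s)).

(** At a position with an earlier representative the new letter is determined;
    at any other position it is free. *)
Lemma consistent_rcons s x : consistent (rcons s x) =
  consistent s && ((root (size s) == size s) || (x == nth 0 s (root (size s)))).
Proof.
rewrite /consistent size_rcons -addn1 iotaD all_cat /= andbT add0n.
congr (_ && _).
  apply: eq_in_all => t; rewrite mem_iota /= add0n => ts.
  by rewrite !nth_rcons ts (leq_ltn_trans (root_le t) ts).
rewrite !nth_rcons ltnn eqxx.
have [->|ne] /= := eqVneq (root (size s)) (size s); first by rewrite ltnn !eqxx.
by rewrite ltn_neqAle ne root_le.
Qed.

(** Rows and columns are never identified with each other, so the letter forced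
    at an old position always lies in the right alphabet. *)
Lemma count_consistent_words n m k :
  \sum_(s <- words n m k | consistent s) 1 =
  \prod_(t <- iota 0 k | root t == t) alphabet n m t.
Proof.
elim: k => [|k IH]; first by rewrite /= big_mkcond big_seq1 big_nil.
rewrite -addn1 iotaD big_cat /= add0n -IH addn1 big_mkcond.
rewrite (big_wordsS _ (V := nat)) big_distrl /= [RHS]big_mkcond.
rewrite big_seq [RHS]big_seq; apply: eq_bigr => s /words_alphabet [ss ws].
under eq_bigr do rewrite consistent_rcons ss.
have [cs|] /= := boolP (consistent s); last by rewrite big1.
rewrite mul1n -big_mkcond big_mkcond /= big_cons big_nil.
have [rk|rk] /= := eqVneq (root k) k.
  by rewrite muln1 sum1_size size_iota.
rewrite -big_mkcond count_iota_eq1 //.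
have := ws (root k); rewrite /alphabet root_odd; apply.
by rewrite ltn_neqAle rk root_le.
Qed.

Variable R : realFieldType.
Local Open Scope ring_scope.

(** The weight of the step from position [u] to position [u+1]; [beta] takes
    the row first, whatever the direction of the step. *)
Definition step (beta : nat -> nat -> R) (s : seq nat) (u : nat) : R :=
  if odd u then beta (nth 0%N s u.+1) (nth 0%N s u)
  else beta (nth 0%N s u) (nth 0%N s u.+1).

(** Summing out the last letter costs nothing at an old position and, at a new
    one, at most the bound on the columns or on the rows of [beta ^ 2].  Only
    the first letter is not reached by a step; it accounts for [n]. *)
Lemma sum_consistent_words (beta : nat -> nat -> R) n m d1 d2 k :
  (forall c, (c < m)%N -> \sum_(a <- iota 0 n) beta a c ^+ 2 <= d1%:R) ->
  (forall a, (a < n)%N -> \sum_(c <- iota 0 m) beta a c ^+ 2 <= d2%:R) ->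
  \sum_(s <- words n m k.+1 | consistent s)
     \prod_(t <- iota 1 k | root t == t) step beta s t.-1 ^+ 2 <=
  n%:R * \prod_(t <- iota 1 k | root t == t) (alphabet d1 d2 t)%:R.
Proof.
move=> colb rowb; elim: k => [|k IH].
  rewrite big_nil mulr1; under eq_bigr do rewrite big_nil.
  rewrite -(natr_sum _ _ _ (fun=> 1%N)) ler_nat count_consistent_words /=.
  rewrite big_mkcond big_seq1 /=.
  by have := root_le 0; rewrite leqn0 => ->.
have rw F : \prod_(t <- iota 1 k.+1 | root t == t) F t =
    (\prod_(t <- iota 1 k | root t == t) F t) *
    (if root k.+1 == k.+1 then F k.+1 else 1) :> R.
  rewrite -[k.+1 in LHS]addn1 iotaD big_cat /= add1n.
  by congr (_ * _); rewrite big_mkcond big_seq1.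
rewrite rw mulrA big_mkcond big_wordsS.
have c0 : 0 <= (if root k.+1 == k.+1 then (alphabet d1 d2 k.+1)%:R else 1) :> R.
  by case: ifP.
apply: le_trans (ler_wpM2r c0 IH).
rewrite mulr_suml [leRHS]big_mkcond big_seq [leRHS]big_seq.
apply: ler_sum => s /words_alphabet [ss ws].
under [leLHS]eq_bigr do rewrite consistent_rcons ss rw.
have [cs|] /= := boolP (consistent s); last by rewrite big1.
have stepE x t : (t <= k)%N -> t \in iota 1 k ->
    step beta (rcons s x) t.-1 = step beta s t.-1.
  rewrite mem_iota => tk /andP[t1 _]; rewrite /step !nth_rcons ss prednK //.
  by rewrite !ltnS tk (leqW tk).
under eq_bigr => x _.
  rewrite (_ : \prod_(t <- iota 1 k | _) _ =
    \prod_(t <- iota 1 k | root t == t) step beta s t.-1 ^+ 2); last first.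
    rewrite big_seq_cond [RHS]big_seq_cond; apply: eq_bigr => t /andP[ti _].
    by rewrite stepE //; move: ti; rewrite mem_iota add1n ltnS => /andP[].
  over.
set Q := \prod_(t <- iota 1 k | _) _.
have Q0 : 0 <= Q by apply: prodr_ge0 => t _; exact: sqr_ge0.
have [rk|rk] /= := eqVneq (root k.+1) k.+1; last first.
  rewrite -big_mkcond mulr1 big_const_seq -Monoid.iteropE /=.
  rewrite (count_uniq_mem _ (iota_uniq _ _)).
  by case: (_ \in _).
rewrite -mulr_sumr ler_wpM2l //.
(* The letter before a new column is a row, and conversely. *)
have wk := ws k (ltnSn k).
rewrite /step; under eq_bigr do rewrite !nth_rcons ss ltnn eqxx ltnSn.
move: wk; rewrite /alphabet /=; case: (odd k) => /= wk; last exact: rowb.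
exact: colb.
Qed.

End Consistent.

(** * Pairings of the steps of a closed walk *)

(** The positions of the row and of the column joined by step [t] of a closed
    walk of even length [N]; the last step returns to position [0], a row. *)
Definition left_end (N t : nat) : nat := if odd t then t.+1 %% N else t.
Definition right_end (t : nat) : nat := if odd t then t else t.+1.

Definition edge (N : nat) (s : seq nat) (t : nat) : nat * nat :=
  (nth 0 s (left_end N t), nth 0 s (right_end t)).

Lemma left_end_lt p t : t < p.*2 -> left_end p.*2 t < p.*2.
Proof.
by rewrite /left_end; case: ifP => // _ tp; rewrite ltn_mod (leq_ltn_trans _ tp).
Qed.

Lemma left_end_even p t : odd (left_end p.*2 t) = false.
Proof.
rewrite /left_end; case: (boolP (odd t)) => [ot|/negbTE //].
by rewrite odd_mod ?odd_double //= ot.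
Qed.

Lemma right_end_lt p t : t < p.*2 -> right_end t < p.*2.
Proof.
rewrite /right_end; case: (boolP (odd t)) => // ot tp.
rewrite ltn_neqAle tp andbT; apply: contraNneq ot => e.
by rewrite -[odd t]negbK -oddS e odd_double.
Qed.

Lemma right_end_odd t : odd (right_end t).
Proof. by rewrite /right_end; case: (boolP (odd t)). Qed.

Definition constraints (N : nat) (pi : seq (nat * nat)) : seq (nat * nat) :=
  flatten [seq [:: (left_end N ab.1, left_end N ab.2);
                   (right_end ab.1, right_end ab.2)] | ab <- pi].

Lemma all_constraints N pi (P : pred (nat * nat)) : all P (constraints N pi) =
  all (fun ab => P (left_end N ab.1, left_end N ab.2) &&
                 P (right_end ab.1, right_end ab.2)) pi.
Proof. by elim: pi => //= ab pi; rewrite /constraints /= => ->; rewrite andbA. Qed.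

Definition matched (N : nat) (pi : seq (nat * nat)) (s : seq nat) : bool :=
  all (fun ab => edge N s ab.1 == edge N s ab.2) pi.

Lemma mem_endpoints pi ab : ab \in pi ->
  (ab.1 \in endpoints pi) /\ (ab.2 \in endpoints pi).
Proof.
by move=> abpi; split; apply/flattenP; exists [:: ab.1; ab.2];
  rewrite ?inE ?eqxx ?orbT //; apply/mapP; exists ab.
Qed.

(** A step of a closed walk joins a row to a column, whatever its direction.
    Two matched steps run along the same edge as soon as their rows agree and
    their columns agree, which are equations between letters at positions of
    equal parity. *)
Lemma pairing_root p pi : pi \in pairings p (iota 0 p.*2) ->
  exists root : nat -> nat,
    [/\ forall t, root t <= t, forall t, odd (root t) = odd t,
        {in pi, forall ab,
           root (left_end p.*2 ab.1) = root (left_end p.*2 ab.2) /\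
           root (right_end ab.1) = root (right_end ab.2)} &
        forall s, size s = p.*2 -> matched p.*2 pi s = consistent root s].
Proof.
move=> pip; have pperm := perm_endpoints (size_iota _ _) pip.
have bnd ab : ab \in pi -> ab.1 < p.*2 /\ ab.2 < p.*2.
  by case/mem_endpoints; rewrite !(perm_mem pperm) !mem_iota /= !add0n.
have [|r [rle rodd ridem rN rP]] := @union_find (constraints p.*2 pi) p.*2.
  rewrite all_constraints; apply/allP => ab /bnd [a1 a2] /=.
  by rewrite !left_end_lt ?right_end_lt // !left_end_even !right_end_odd.
exists r; split=> //.
- have /rP : forall t, r t = r (r t) by move=> t; rewrite ridem.
  by rewrite all_constraints => /allP h ab /h /andP[/eqP -> /eqP ->].
- move=> s ss; have -> : matched p.*2 pi s =
      all (fun xy => nth 0 s xy.1 == nth 0 s xy.2) (constraints p.*2 pi).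
    by rewrite all_constraints; apply: eq_all => ab; rewrite xpair_eqE.
  apply/idP/idP => [/rP h|/allP h].
    by apply/allP => t _; rewrite -h.
  apply/rP => t; have [tN|tN] := ltnP t p.*2; last by rewrite rN.
  by apply/eqP/h; rewrite mem_iota ss.
Qed.

Lemma edge_step (R : realFieldType) (beta : nat -> nat -> R) N s u : u.+1 < N ->
  beta (edge N s u).1 (edge N s u).2 = step beta s u.
Proof.
by move=> uN; rewrite /edge /left_end /right_end /step modn_small //; case: ifP.
Qed.

Lemma double_pos_succ p : 0 < p -> p.*2 = p.*2.-1.+1.
Proof. by case: p. Qed.

Lemma big_endpoints (R : Type) (idx : R) (op : Monoid.com_law idx)
    (pi : seq (nat * nat)) (s : seq nat) (F : nat -> R) :
  perm_eq (endpoints pi) s ->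
  \big[op/idx]_(t <- s) F t = \big[op/idx]_(ab <- pi) op (F ab.1) (F ab.2).
Proof.
move=> pe; rewrite -(perm_big _ pe) /endpoints big_flatten big_map.
by apply: eq_bigr => ab _; rewrite !big_cons big_nil Monoid.mulm1.
Qed.

Section Domination.
Variable R : realFieldType.
Local Open Scope ring_scope.

(** Matched steps have equal weights, so that a matched pair [a < b]
    contributes [beta_a ^ 2].  If step [a] leads to a new vertex this weight
    is kept, and otherwise it is bounded by [1].  Step [b] never leads to a
    new vertex: its endpoints are the endpoints of the earlier step [a]. *)
Lemma prod_edges_le (beta : nat -> nat -> R) p pi s (root : nat -> nat) :
  (0 < p)%N -> (forall a c, 0 <= beta a c <= 1) ->
  pi \in pairings p (iota 0 p.*2) -> matched p.*2 pi s ->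
  (forall t, root t <= t)%N ->
  {in pi, forall ab, root (left_end p.*2 ab.1) = root (left_end p.*2 ab.2) /\
           root (right_end ab.1) = root (right_end ab.2)} ->
  \prod_(t <- iota 0 p.*2) beta (edge p.*2 s t).1 (edge p.*2 s t).2 <=
  \prod_(t <- iota 1 p.*2.-1 | root t == t) step beta s t.-1 ^+ 2.
Proof.
move=> p0 b01 pip /allP ms rle rpi; set N := p.*2 in rpi ms *.
pose B t := beta (edge N s t).1 (edge N s t).2.
(* What step [u] retains: the squared weight if it leads to a new vertex. *)
pose G u := if (u.+1 < N)%N && (root u.+1 == u.+1) then B u ^+ 2 else 1.
have NE : N = N.-1.+1 := double_pos_succ p0.
have -> : \prod_(t <- iota 1 N.-1 | root t == t) step beta s t.-1 ^+ 2 =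
    \prod_(t <- iota 0 N) G t.
  rewrite (iotaDl 1 0 N.-1) big_map big_mkcond.
  rewrite [in RHS]NE -[N.-1.+1]addn1 iotaD big_cat /=.
  rewrite [X in _ = _ * X]big_seq1 [X in _ = _ * X]/G add0n -NE ltnn mulr1.
  rewrite big_seq [RHS]big_seq; apply: eq_bigr => u.
  rewrite mem_iota /= add0n add1n /G => uN.
  have uN' : (u.+1 < N)%N by rewrite NE ltnS.
  by rewrite uN' /=; case: ifP => // _; rewrite /B edge_step.
have pperm := perm_endpoints (size_iota _ _) pip.
rewrite !(big_endpoints _ _ pperm) big_seq [leRHS]big_seq.
apply: ler_prod => -[a b] abpi /=; rewrite -/(B a) -/(B b).
have ab : (a < b)%N := allP (pairings_ltn (iota_ltn_sorted _ _) pip) _ abpi.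
have Bab : B a = B b by rewrite /B (eqP (ms _ abpi)).
have [B0 B1] : 0 <= B a /\ B a <= 1 by have /andP[] := b01 (edge N s a).1 (edge N s a).2.
apply/andP; split; first by rewrite -Bab mulr_ge0.
have -> : G b = 1.
  rewrite /G; case: ifP => // /andP[bN /eqP rb]; exfalso.
  have aN : (a.+1 < N)%N by apply: leq_trans bN; rewrite ltnS ltnW.
  have [] := rpi _ abpi; rewrite /= /left_end /right_end !modn_small //.
  (* [b+1] is identified with [a+1] if [a] and [b] have the same parity, and
     with [a] otherwise: in both cases with an earlier position. *)
  have contra x : (x <= a.+1)%N -> root x <> root b.+1.
    by move=> xa e; have := rle x; rewrite e rb leqNgt ltnS (leq_trans xa).
  case: (odd a); case: (odd b) => h1 h2.
  - by apply: (contra a.+1).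
  - by apply: (contra a) => //.
  - by apply: (contra a) => //.
  - by apply: (contra a.+1).
rewrite mulr1 -Bab /G; case: ifP => _; first by rewrite expr2.
by rewrite mulr_ile1.
Qed.

(** The product of the alphabet sizes over the new vertices is an upper bound
    on the left and an exact count on the right, up to the factors [n] and
    [d1] coming from the starting vertex. *)
Lemma pairing_sum_le (beta : nat -> nat -> R) n m d1 d2 p pi :
  (0 < p)%N -> (forall a c, 0 <= beta a c <= 1) ->
  (forall c, (c < m)%N -> \sum_(a <- iota 0 n) beta a c ^+ 2 <= d1%:R) ->
  (forall a, (a < n)%N -> \sum_(c <- iota 0 m) beta a c ^+ 2 <= d2%:R) ->
  pi \in pairings p (iota 0 p.*2) ->
  d1%:R * (\sum_(s <- words n m p.*2 | matched p.*2 pi s)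
     \prod_(t <- iota 0 p.*2) beta (edge p.*2 s t).1 (edge p.*2 s t).2) <=
  n%:R * \sum_(s <- words d1 d2 p.*2 | matched p.*2 pi s) 1.
Proof.
move=> p0 b01 colb rowb pip.
have [r [rle rodd rpi rP]] := pairing_root pip.
have mE n' m' (F : seq nat -> R) :
    \sum_(s <- words n' m' p.*2 | matched p.*2 pi s) F s =
    \sum_(s <- words n' m' p.*2 | consistent r s) F s.
  rewrite big_seq_cond [RHS]big_seq_cond; apply: eq_bigl => s.
  by case: (boolP (s \in _)) => //= /words_alphabet [ss _]; rewrite rP.
rewrite [X in _ <= _ * X]mE -(natr_sum _ _ _ (fun=> 1%N)).
rewrite (count_consistent_words rle rodd).
have r0 : r 0 = 0%N by apply/eqP; rewrite -leqn0.
have -> : (\prod_(t <- iota 0 p.*2 | r t == t) alphabet d1 d2 t =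
    d1 * \prod_(t <- iota 1 p.*2.-1 | r t == t) alphabet d1 d2 t)%N.
  by rewrite [in LHS](double_pos_succ p0) /= big_cons r0 eqxx.
rewrite natrM mulrCA ler_wpM2l //.
apply: le_trans (_ : _ <= \sum_(s <- words n m p.*2 | consistent r s)
   \prod_(t <- iota 1 p.*2.-1 | r t == t) step beta s t.-1 ^+ 2) _.
  rewrite mE big_seq_cond [leRHS]big_seq_cond.
  apply: ler_sum => s /andP[/words_alphabet [ss _] cs].
  by apply: (prod_edges_le p0 b01 pip) => //; rewrite rP.
rewrite [in leLHS](double_pos_succ p0) natr_prod.
exact: sum_consistent_words.
Qed.

(** The entry of an [n+1] by [m+1] matrix met at step [t]. *)
Definition entry_index n m N s t : 'I_n.+1 * 'I_m.+1 :=
  (inord (edge N s t).1, inord (edge N s t).2).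

Lemma entry_index_eq n m p s a b : s \in words n.+1 m.+1 p.*2 ->
  (a < p.*2)%N -> (b < p.*2)%N ->
  (entry_index n m p.*2 s a == entry_index n m p.*2 s b) =
  (edge p.*2 s a == edge p.*2 s b).
Proof.
move=> /words_alphabet [_ ws] aN bN; rewrite !xpair_eqE.
have L t : (t < p.*2)%N -> ((edge p.*2 s t).1 < n.+1)%N.
  move=> tN; have := ws _ (left_end_lt tN).
  by rewrite /alphabet left_end_even.
have Rt t : (t < p.*2)%N -> ((edge p.*2 s t).2 < m.+1)%N.
  move=> tN; have := ws _ (right_end_lt tN).
  by rewrite /alphabet right_end_odd.
by congr (_ && _); rewrite -val_eqE /= !inordK ?L ?Rt.
Qed.

(** The expectation of the product of the entries of a standard Gaussian matrix
    along the walk [s]. *)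
Definition gaussian_weight n m p (s : seq nat) : nat :=
  (\prod_(e : 'I_n.+1 * 'I_m.+1)
    gaussian_moment (count (fun t => entry_index n m p.*2 s t == e) (iota 0 p.*2)))%N.

Lemma gaussian_weightE n m p s : s \in words n.+1 m.+1 p.*2 ->
  (gaussian_weight n m p s = \sum_(pi <- pairings p (iota 0 p.*2)) matched p.*2 pi s)%N.
Proof.
move=> sw; rewrite /gaussian_weight -(@wick _ _ p) ?size_iota //.
rewrite big_seq [RHS]big_seq; apply: eq_bigr => pi pip; congr nat_of_bool.
have pperm := perm_endpoints (size_iota _ _) pip.
apply: eq_in_all => ab /mem_endpoints [].
rewrite !(perm_mem pperm) !mem_iota /= !add0n => a1 a2.
exact: entry_index_eq.
Qed.

(** Wick's formula turns both sides into sums over pairings, which are compared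
    term by term. *)
Theorem gaussian_domination (beta : nat -> nat -> R) n m d1 d2 p :
  (0 < p)%N -> (forall a c, 0 <= beta a c <= 1) ->
  (forall c, (c < m.+1)%N -> \sum_(a <- iota 0 n.+1) beta a c ^+ 2 <= d1.+1%:R) ->
  (forall a, (a < n.+1)%N -> \sum_(c <- iota 0 m.+1) beta a c ^+ 2 <= d2.+1%:R) ->
  d1.+1%:R * (\sum_(s <- words n.+1 m.+1 p.*2)
    (\prod_(t <- iota 0 p.*2) beta (edge p.*2 s t).1 (edge p.*2 s t).2) *
    (gaussian_weight n m p s)%:R) <=
  n.+1%:R * \sum_(s <- words d1.+1 d2.+1 p.*2) (gaussian_weight d1 d2 p s)%:R.
Proof.
move=> p0 b01 colb rowb.
have expand n' m' (F : seq nat -> R) :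
    \sum_(s <- words n'.+1 m'.+1 p.*2) F s * (gaussian_weight n' m' p s)%:R =
    \sum_(pi <- pairings p (iota 0 p.*2))
      \sum_(s <- words n'.+1 m'.+1 p.*2 | matched p.*2 pi s) F s.
  rewrite [RHS](eq_bigr _ (fun pi _ => big_mkcond _ _)) exchange_big /=.
  rewrite big_seq [RHS]big_seq; apply: eq_bigr => s /gaussian_weightE ->.
  rewrite natr_sum mulr_sumr; apply: eq_bigr => pi _.
  by case: matched; rewrite ?mulr1 ?mulr0.
have -> : \sum_(s <- words d1.+1 d2.+1 p.*2) (gaussian_weight d1 d2 p s)%:R =
    \sum_(s <- words d1.+1 d2.+1 p.*2) 1 * (gaussian_weight d1 d2 p s)%:R :> R.
  by apply: eq_bigr => s _; rewrite mul1r.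
rewrite !expand !mulr_sumr big_seq [leRHS]big_seq.
by apply: ler_sum => pi pip; apply: pairing_sum_le.
Qed.

End Domination.

(** * The trace as a sum over closed walks *)

Section Trace.
Variables (R : realFieldType) (n m : nat) (X : 'M[R]_(n.+1, m.+1)).
Local Open Scope ring_scope.

Let x (a c : nat) : R := X (inord a) (inord c).

Lemma sum_iota_ord k (F : nat -> R) :
  \sum_(a <- iota 0 k) F a = \sum_(i < k) F i.
Proof. by rewrite -(big_mkord xpredT) /index_iota subn0. Qed.

Lemma gram_entry i j : (X *m X^T) i j = \sum_(c <- iota 0 m.+1) x i c * x j c.
Proof.
rewrite mxE sum_iota_ord; apply: eq_bigr => c _.
by rewrite mxE /x !inord_val.
Qed.

Lemma prod_iotaSS k (F : nat -> R) : \prod_(t <- iota 0 k.+2) F t =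
  (\prod_(t <- iota 0 k) F t) * (F k * F k.+1).
Proof.
by rewrite -[k.+2]addn2 iotaD big_cat /= big_cons big_seq1 add0n.
Qed.

(** Keeping an arbitrary function [H] of both endpoints makes the induction on
    the length go through, the two new steps being absorbed into [H]. *)
Lemma sum_open_walks k (H : nat -> nat -> R) :
  \sum_(s <- words n.+1 m.+1 k.*2.+1)
    (\prod_(t <- iota 0 k.*2) step x s t) * H (nth 0%N s 0) (nth 0%N s k.*2) =
  \sum_i \sum_j ((X *m X^T) ^+ k) i j * H i j.
Proof.
elim: k H => [|k IH] H.
  rewrite (big_wordsS _ (V := R)) big_seq1 sum_iota_ord.
  apply: eq_bigr => i _; rewrite big_nil mul1r /= (bigD1 i) //= big1.
    by rewrite expr0 mxE eqxx mul1r addr0.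
  by move=> j ji; rewrite expr0 mxE eq_sym (negbTE ji) mul0r.
pose H' i j := \sum_(c <- iota 0 m.+1) \sum_(a <- iota 0 n.+1)
                 x j c * x a c * H i a.
transitivity (\sum_i \sum_j ((X *m X^T) ^+ k) i j * H' i j).
  rewrite -IH doubleS [LHS](big_wordsS _ (V := R)) [LHS](big_wordsS _ (V := R)).
  rewrite big_seq [RHS]big_seq; apply: eq_bigr => s /words_alphabet [ss _].
  under [LHS]eq_bigr => c _ do under eq_bigr => a _ do rewrite prod_iotaSS.
  rewrite [in RHS]/H' mulr_sumr /alphabet /= odd_double.
  apply: eq_bigr => c _.
  rewrite mulr_sumr; apply: eq_bigr => a _.
  rewrite (eq_big_seq (step x s)); last first.
    move=> t; rewrite mem_iota /= add0n => tk.
    by rewrite /step !nth_rcons !size_rcons ss !ltnS tk (ltnW tk) ltnW // ltnW.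
  set s' := rcons _ a.
  have sE t : (t <= k.*2)%N -> nth 0%N s' t = nth 0%N s t.
    by move=> tk; rewrite !nth_rcons size_rcons ss !ltnS tk leqW.
  have cE : nth 0%N s' k.*2.+1 = c.
    by rewrite !nth_rcons size_rcons ss ltnSn ltnn eqxx.
  have aE : nth 0%N s' k.*2.+2 = a.
    by rewrite nth_rcons size_rcons ss ltnn eqxx.
  by rewrite /step /= odd_double /= aE cE !sE // !mulrA.
apply: eq_bigr => i _; rewrite /H'.
under eq_bigr do (rewrite exchange_big sum_iota_ord mulr_sumr).
rewrite exchange_big; apply: eq_bigr => a _ /=.
rewrite exprSr [X in _ = X * _]mxE mulr_suml; apply: eq_bigr => j _.
by rewrite -mulrA gram_entry mulr_suml.
Qed.

Lemma trace_gram_power p : (0 < p)%N ->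
  \tr ((X *m X^T) ^+ p) =
  \sum_(s <- words n.+1 m.+1 p.*2) \prod_(t <- iota 0 p.*2)
     X (entry_index n m p.*2 s t).1 (entry_index n m p.*2 s t).2.
Proof.
case: p => // k _; rewrite doubleS.
pose H i j := \sum_(c <- iota 0 m.+1) x j c * x i c.
transitivity (\sum_i \sum_j ((X *m X^T) ^+ k) i j * H i j).
  apply: eq_bigr => i _; rewrite exprSr mxE; apply: eq_bigr => j _.
  by rewrite gram_entry.
rewrite -(sum_open_walks _ H) [RHS](big_wordsS _ (V := R)).
rewrite big_seq [RHS]big_seq; apply: eq_bigr => s /words_alphabet [ss _].
under [RHS]eq_bigr => c _ do rewrite prod_iotaSS.
rewrite mulr_sumr /alphabet /= odd_double /=; apply: eq_bigr => c _.
rewrite [in RHS](eq_big_seq (step x s)); last first.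
  move=> t; rewrite mem_iota /= add0n => tk.
  rewrite -[LHS]/(x _ _) edge_step; last by rewrite !ltnS ltnW.
  by rewrite /step !nth_rcons ss !ltnS tk (ltnW tk).
rewrite /entry_index /edge /left_end /right_end /= odd_double /= modnn.
by rewrite !nth_rcons ss !ltnS leqnn ltnn eqxx /= /x.
Qed.

End Trace.

(** * Integrals determined by their values on indicators *)

Section Measure.
Local Open Scope classical_set_scope.
Local Open Scope ring_scope.

Section Density.
Context {dT dS : measure_display} {T : measurableType dT} {S : measurableType dS}.
Context {R : realType} (mu : {measure set T -> \bar R}).
Variables (phi : T -> S) (h : T -> R).
Hypothesis mphi : measurable_fun [set: T] phi.
Hypothesis mh : measurable_fun [set: T] h.
Hypothesis h0 : forall x, 0 <= h x.

Import HBNNSimple.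

Let integral_nnsfun_density (g : {nnsfun S >-> R}) :
  (\int[mu]_x (g (phi x) * h x)%:E =
   \sum_(r \in range g) r%:E * \int[mu]_x (\1_(g @^-1` [set r]) (phi x) * h x)%:E)%E.
Proof.
have mI r : measurable_fun [set: T]
    (fun x => (\1_(g @^-1` [set r]) (phi x) * h x)%:E : \bar R).
  apply/measurable_EFinP; apply: measurable_funM => //.
  by apply: measurableT_comp => //; exact: measurable_indic.
transitivity (\int[mu]_x (\sum_(r \in range g)
    r%:E * (\1_(g @^-1` [set r]) (phi x) * h x)%:E))%E.
  apply: eq_integral => x _; rewrite {1}fimfunE EFinM -fsumEFin//.
  rewrite ge0_mule_fsuml => [|y]; last exact: nnfun_muleindic_ge0.
  by apply: eq_fsbigr => r _; rewrite !EFinM muleA.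
rewrite ge0_integral_fsum//; last 2 first.
- by move=> r; apply: measurable_funeM.
- move=> r x _; rewrite EFinM muleA; apply: mule_ge0; rewrite ?lee_fin//.
  exact: (nnfun_muleindic_ge0 g r (phi x)).
apply: eq_fsbigr => r; rewrite inE => -[y _ <-].
rewrite ge0_integralZl//; last by rewrite lee_fin.
by move=> x _; rewrite lee_fin mulr_ge0.
Qed.

Lemma integral_density_lim (f : S -> R) (mf : measurable_fun [set: S] (EFin \o f)) :
  (forall y, 0 <= f y) ->
  (\int[mu]_x (f (phi x) * h x)%:E =
   limn (fun n => \sum_(r \in range (nnsfun_approx measurableT mf n)) r%:E *
     \int[mu]_x (\1_(nnsfun_approx measurableT mf n @^-1` [set r]) (phi x) * h x)%:E))%E.
Proof.
move=> f0; pose g := nnsfun_approx measurableT mf.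
transitivity (limn (fun n => \int[mu]_x (g n (phi x) * h x)%:E)%E); last first.
  by congr (limn _); apply/funext => n; rewrite integral_nnsfun_density.
rewrite -monotone_convergence//=; last 3 first.
- move=> n; apply/measurable_EFinP; apply: measurable_funM => //.
  exact: measurableT_comp.
- by move=> n x _; rewrite lee_fin mulr_ge0.
- move=> x _ a b ab; rewrite lee_fin ler_wpM2r//.
  exact/lefP/nd_nnsfun_approx.
apply: eq_integral => x _; apply/esym/cvg_lim => //.
rewrite EFinM; under eq_fun do rewrite EFinM.
apply: cvgeZr => //; apply: cvg_nnsfun_approx => // y _.
by rewrite /= lee_fin.
Qed.

End Density.

Import HBNNSimple.

(** Two weighted measures that give the same mass to the preimages of every
    measurable set integrate every nonnegative function alike.  This one
    principle serves to change variables, to integrate against a density and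
    to use independence. *)
Lemma eq_integral_density {dT1 dT2 dS : measure_display}
    {T1 : measurableType dT1} {T2 : measurableType dT2} {S : measurableType dS}
    {R : realType} (mu1 : {measure set T1 -> \bar R})
    (mu2 : {measure set T2 -> \bar R}) (phi1 : T1 -> S) (phi2 : T2 -> S)
    (h1 : T1 -> R) (h2 : T2 -> R) (f : S -> R) :
  measurable_fun [set: T1] phi1 -> measurable_fun [set: T2] phi2 ->
  measurable_fun [set: T1] h1 -> measurable_fun [set: T2] h2 ->
  (forall x, 0 <= h1 x)%R -> (forall x, 0 <= h2 x)%R ->
  (forall A : set S, measurable A ->
    (\int[mu1]_x (\1_A (phi1 x) * h1 x)%:E = \int[mu2]_x (\1_A (phi2 x) * h2 x)%:E)%E) ->
  measurable_fun [set: S] f -> (forall y, 0 <= f y)%R ->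
  (\int[mu1]_x (f (phi1 x) * h1 x)%:E = \int[mu2]_x (f (phi2 x) * h2 x)%:E)%E.
Proof.
move=> m1 m2 mh1 mh2 h10 h20 H /measurable_EFinP mf f0.
rewrite !(@integral_density_lim _ _ _ _ _ _ _ _ _ _ _ f mf)//.
congr (limn _); apply/funext => n; apply: eq_fsbigr => r _; congr (_ * _)%E.
apply: H; rewrite -[X in measurable X]setTI.
exact: (measurable_funP (nnsfun_approx measurableT mf n)).
Qed.

End Measure.

(** * Products of independent random variables *)

Section Independence.
Local Open Scope classical_set_scope.
Local Open Scope ring_scope.
Context {d : measure_display} {T : measurableType d} {R : realType}.
Variable P : probability T R.
Variables (I : finType) (xi : I -> {RV P >-> R}).
Hypothesis xi_indep : mutually_independent xi.

Lemma measurable_prod_comp (J : pred I) (f : I -> R -> R) :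
  (forall i, measurable_fun [set: R] (f i)) ->
  measurable_fun [set: T] (fun w => \prod_(i | J i) f i (xi i w)).
Proof.
move=> mf; under eq_fun do rewrite big_mkcond.
apply: measurable_prod => i _; case: (J i) => //.
by apply: measurableT_comp => //; exact: mf.
Qed.

Lemma integral_indic_preimage (X : {RV P >-> R}) (A : set R) : measurable A ->
  (\int[P]_w (\1_A (X w))%:E = P (X @^-1` A))%E.
Proof.
move=> mA; rewrite -[in RHS](classical_sets.setIT (X @^-1` A)) -integral_indic //.
by rewrite -[X in measurable X]setTI; apply: measurable_funP.
Qed.

(** Independence is the case where every [f i] is an indicator.  The general
    case is reached by replacing the indicators one index at a time: with the
    other factors fixed, both sides are weighted integrals of [f i0] that
    agree on indicators. *)
Lemma ge0_integral_prod_indep (f : I -> R -> R) (a : I -> R) :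
  (forall i, measurable_fun [set: R] (f i)) -> (forall i x, 0 <= f i x) ->
  (forall i, \int[P]_w (f i (xi i w))%:E = (a i)%:E)%E ->
  (\int[P]_w (\prod_i f i (xi i w))%:E = (\prod_i a i)%:E)%E.
Proof.
suff Q (s : seq I) (g : I -> R -> R) (c : I -> R) :
    (forall i, measurable_fun [set: R] (g i)) -> (forall i x, 0 <= g i x) ->
    (forall i, \int[P]_w (g i (xi i w))%:E = (c i)%:E)%E ->
    (forall i, i \notin s -> exists2 A, measurable A & g i = \1_A) ->
    (\int[P]_w (\prod_i g i (xi i w))%:E = (\prod_i c i)%:E)%E.
  move=> mf f0 fa; apply: (Q (enum I)) => // i.
  by rewrite mem_enum.
elim: s g c => [|i0 s IH] g c mg g0 gc gA.
  have /choice [A hA] : forall i, exists A, measurable A /\ g i = \1_A.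
    by move=> i; have [A mA gi] := gA i isT; exists A.
  have gE w : \prod_i g i (xi i w) =
      \1_(\bigcap_(i in [set` [set: I]%SET]) (xi i @^-1` A i)) w.
    rewrite indicE; have [/set_mem wA|] := boolP (_ \in _).
      rewrite big1 // => i _; have [_ ->] := hA i.
      by rewrite indicE mem_set //; apply: wA; rewrite /= finset.in_setT.
    move=> wA; have [i wi] : exists i, ~ A i (xi i w).
      apply: contrapT => /forallNP h; move/negP: wA; apply; apply/mem_set => i _.
      by have /contrapT := h i.
    rewrite (bigD1 i) //=; have [_ ->] := hA i.
    by rewrite indicE memNset // mul0r.
  under eq_integral do rewrite gE.
  have mX i : measurable (xi i @^-1` A i).
    by rewrite -[X in measurable X]setTI; apply: measurable_funP => //; case: (hA i).
  rewrite integral_indic //; last first.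
    by apply: fin_bigcap_measurable => // ; exact: finite_finset.
  rewrite classical_sets.setIT.
  transitivity (\prod_(i in [set: I]%SET) P (xi i @^-1` A i))%E.
    by apply: xi_indep => i _; case: (hA i).
  rewrite [LHS](eq_bigl xpredT); last by move=> i; rewrite finset.in_setT.
  rewrite -prodEFin; apply: eq_bigr => i _; rewrite -gc.
  by have [mA ->] := hA i; rewrite integral_indic_preimage.
pose h w := \prod_(i | i != i0) g i (xi i w).
pose k := \prod_(i | i != i0) c i.
have c0 i : 0 <= c i.
  by rewrite -lee_fin -gc; apply: integral_ge0 => w _; rewrite lee_fin.
have k0 : 0 <= k by exact: prodr_ge0.
have mh : measurable_fun [set: T] h by exact: measurable_prod_comp.
rewrite (bigD1 i0) //= -/k.
under eq_integral do rewrite (bigD1 i0) //= -/(h _).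
rewrite (@eq_integral_density _ _ _ _ _ _ _ P P _ (xi i0) h (cst k)) //=; first last.
- move=> A mA; have mXA : measurable (xi i0 @^-1` A).
    by rewrite -[X in measurable X]setTI; apply: measurable_funP.
  pose g' i := if i == i0 then \1_A else g i.
  pose c' i := if i == i0 then fine (P (xi i0 @^-1` A)) else c i.
  transitivity (\int[P]_w (\prod_i g' i (xi i w))%:E)%E.
    apply: eq_integral => w _; rewrite (bigD1 i0) //= /g' eqxx; congr (_ * _)%:E.
    by apply: eq_bigr => i /negbTE ->.
  rewrite (IH g' c'); first last.
  + move=> i si; rewrite /g'; case: eqP => [_|/eqP ii]; first by exists A.
    by apply: gA; rewrite inE negb_or ii.
  + move=> i; rewrite /g' /c'; case: eqP => [->|_] //.
    by rewrite integral_indic_preimage // fineK // fin_num_measure.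
  + by move=> i x; rewrite /g'; case: eqP.
  + move=> i; rewrite /g'; case: eqP => // _; exact: measurable_indic.
  rewrite (bigD1 i0) //= /c' eqxx; under eq_bigr => i /negbTE -> do [].
  under eq_integral do rewrite EFinM.
  rewrite ge0_integralZr //.
  - rewrite integral_indic_preimage // EFinM fineK // fin_num_measure //.
  - by apply/measurable_EFinP; apply: measurable_indic.
- by move=> w; rewrite /h; apply: prodr_ge0 => i _; exact: g0.
under eq_integral do rewrite EFinM.
rewrite ge0_integralZr //.
- by rewrite gc.
- by apply/measurable_EFinP; apply: measurableT_comp => //; exact: mg.
- by move=> x _; rewrite lee_fin.
Qed.

(** Each factor is split into its positive and negative part, and the product is
    expanded over all choices of signs. *)
Lemma integral_prod_indep (f : I -> R -> R) (a : I -> R) :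
  (forall i, measurable_fun [set: R] (f i)) ->
  (forall i, P.-integrable [set: T] (fun w => (f i (xi i w))%:E)) ->
  (forall i, \int[P]_w (f i (xi i w))%:E = (a i)%:E)%E ->
  P.-integrable [set: T] (fun w => (\prod_i f i (xi i w))%:E) /\
  (\int[P]_w (\prod_i f i (xi i w))%:E = (\prod_i a i)%:E)%E.
Proof.
move=> mf intf fa.
pose g (b : bool) i : R -> R := if b then (f i)^\+ else (f i)^\-.
have mg b i : measurable_fun [set: R] (g b i).
  by rewrite /g; case: b; [exact: measurable_funrpos | exact: measurable_funrneg].
have g0 b i x : 0 <= g b i x by rewrite /g; case: b.
have fE i x : f i x = \sum_(b : bool) (-1) ^+ (~~ b) * g b i x.
  by rewrite big_bool /= expr0 expr1 mul1r mulN1r -[in LHS](funrposBneg (f i)).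
pose c b i := fine (\int[P]_w (g b i (xi i w))%:E)%E.
have intg b i : P.-integrable [set: T] (fun w => (g b i (xi i w))%:E).
  case: b; first exact: (integrable_funrpos measurableT (intf i)).
  exact: (integrable_funrneg measurableT (intf i)).
have gc b i : (\int[P]_w (g b i (xi i w))%:E = (c b i)%:E)%E.
  by rewrite fineK //; apply: integrable_fin_num.
have aE i : a i = \sum_(b : bool) (-1) ^+ (~~ b) * c b i.
  apply: EFin_inj; rewrite -fa; under eq_integral do rewrite fE big_bool /=.
  rewrite big_bool /= expr0 expr1 mul1r mulN1r EFinD EFinN -!gc.
  rewrite -integralB //; apply: eq_integral => w _.
  by rewrite mul1r mulN1r EFinD EFinN.
pose G (s : {ffun I -> bool}) w := \prod_i g (s i) i (xi i w).
pose e (s : {ffun I -> bool}) : R := \prod_i (-1) ^+ (~~ s i).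
have prodE w : \prod_i f i (xi i w) = \sum_(s : {ffun I -> bool}) e s * G s w.
  under eq_bigr do rewrite fE.
  by rewrite bigA_distr_bigA; apply: eq_bigr => s _; rewrite big_split.
have GE s : (\int[P]_w (G s w)%:E = (\prod_i c (s i) i)%:E)%E.
  by apply: (@ge0_integral_prod_indep (fun i => g (s i) i)) => // i; exact: gc.
have intG s : P.-integrable [set: T] (fun w => (G s w)%:E).
  apply/integrableP; split.
    by apply/measurable_EFinP; apply: (@measurable_prod_comp xpredT (fun i => g (s i) i)).
  under eq_integral => w _ do rewrite abse_EFin ger0_norm ?prodr_ge0 //.
  by rewrite GE ltry.
have inteG s : P.-integrable [set: T] (fun w => (e s * G s w)%:E).
  by under eq_fun do rewrite EFinM; apply: integrableZl.
split.
  under eq_fun do rewrite prodE -sumEFin.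
  exact: integrable_sum.
under eq_integral do rewrite prodE -sumEFin.
rewrite integral_sum //; under [in RHS]eq_bigr do rewrite aE.
rewrite bigA_distr_bigA -sumEFin; apply: eq_bigr => s _.
rewrite big_split EFinM -GE; under eq_integral do rewrite EFinM.
exact: integralZl.
Qed.

End Independence.

(** * Gaussian moments *)

Section GaussianMoments.
Local Open Scope classical_set_scope.
Local Open Scope ring_scope.
Context {R : realType}.
Notation mu := (@lebesgue_measure R).
Notation pdf := (@normal_pdf R 0 1).

Lemma normal_pdf01E : pdf = fun x => normal_peak 1 * expR (- x ^+ 2 / 2).
Proof.
rewrite normal_pdfE ?oner_neq0 //; apply/funext => x.
by rewrite /normal_fun subr0 expr1n.
Qed.

Lemma is_derive_normal_pdf01 (x : R) : is_derive x 1 pdf (- x * pdf x).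
Proof.
rewrite normal_pdf01E.
have -> : (fun x : R => normal_peak 1 * expR (- x ^+ 2 / 2)) =
    normal_peak 1 *: (expR \o ((- 2^-1) *: (@id R ^+ 2))) :> (R -> R).
  by apply/funext => y; rewrite !fctE /= /GRing.scale /= !mulNr [2^-1 * _]mulrC.
have H : is_derive x 1 ((- 2^-1) *: ((@id R ^+ 2) : R -> R)) (- x).
  by apply: is_derive_eq; rewrite /GRing.scale /=; field.
have H2 := @is_derive1_comp R expR _ x _ _ (is_derive_expR _) H.
apply: is_derive_eq; rewrite !fctE /GRing.scale /=.
by rewrite mulNr [2^-1 * _]mulrC -mulNr; ring.
Qed.

Lemma continuous_normal_pdf01 : continuous pdf.
Proof. by apply: continuous_normal_pdf; rewrite oner_neq0. Qed.

(** The density satisfies [pdf' = - x pdf], so that [x * pdf] has the primitive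
    [- pdf]. *)
Lemma moment_by_parts k n : (0 < n)%N ->
  (\int[mu]_(x in `[0%R, n%:R]) (x ^+ k.+1.*2 * pdf x)%R%:E =
   (- (n%:R ^+ k.*2.+1 * pdf n%:R))%:E +
   k.*2.+1%:R%:E * \int[mu]_(x in `[0%R, n%:R]) (x ^+ k.*2 * pdf x)%R%:E)%E.
Proof.
move=> n0.
have cpdf := continuous_normal_pdf01.
have cX m : continuous (fun x : R => x ^+ m) by move=> x; exact: exprn_continuous.
have cN : continuous (fun x : R => - pdf x) by move=> x; apply: cvgN; exact: cpdf.
have cid : continuous (fun x : R => x * pdf x).
  by move=> x; apply: cvgM; [exact: cvg_id | exact: cpdf].
have cf : continuous (fun x : R => k.*2.+1%:R * x ^+ k.*2).
  by move=> x; apply: cvgM; [exact: cvg_cst | exact: cX].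
have d1 (x : R) : is_derive x 1 (fun x : R => x ^+ k.*2.+1) (k.*2.+1%:R * x ^+ k.*2).
  by apply: DeriveDef; [exact: exprn_derivable | rewrite exp_derive scaler1 -mulr_natl].
have d2 (x : R) : is_derive x 1 (fun x : R => - pdf x) (x * pdf x).
  have H := is_derive_normal_pdf01 x.
  by apply: is_derive_eq; rewrite mulNr opprK.
have LR (f : R -> R) a b : continuous f -> (forall x, derivable f x 1) ->
    derivable_oo_LRcontinuous f a b.
  move=> cf' df; split; first by move=> x _; exact: df.
    exact/cvg_at_right_filter/cf'.
  exact/cvg_at_left_filter/cf'.
have := @integration_by_parts R (fun x => x ^+ k.*2.+1) (fun x => - pdf x)
  (fun x => k.*2.+1%:R * x ^+ k.*2) (fun x => x * pdf x) 0 n%:R.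
rewrite ltr0n => /(_ n0) H.
transitivity (\int[mu]_(x in `[0%R, n%:R]) (x ^+ k.*2.+1 * (x * pdf x))%:E)%E.
  by apply: eq_integral => x _; rewrite mulrA -exprSr.
rewrite H; last 6 first.
- exact: continuous_subspaceT.
- by apply: LR => // x; case: (d1 x).
- by move=> x _; rewrite derive1E; case: (d1 x).
- exact: continuous_subspaceT.
- by apply: LR => // x; case: (d2 x).
- by move=> x _; rewrite derive1E; case: (d2 x).
rewrite expr0n /= mul0r subr0 mulrN; congr (_ + _)%E.
have x0 (x : R) : `[0%R, n%:R]%classic x -> 0 <= x ^+ k.*2 * pdf x.
  move=> _; rewrite mulr_ge0 ?normal_pdf_ge0 //.
  by rewrite exprn_even_ge0 // odd_double.
transitivity (- \int[mu]_(x in `[0%R, n%:R])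
    - (k.*2.+1%:R%:E * (x ^+ k.*2 * pdf x)%R%:E))%E.
  by congr (- _)%E; apply: eq_integral => x _; rewrite mulrN -mulrA EFinN EFinM.
rewrite integral_ge0N; last first.
  by move=> x xn; rewrite mule_ge0 ?lee_fin // x0.
rewrite oppeK ge0_integralZl //.
- apply/measurable_EFinP; apply: measurable_funTS.
  by apply: continuous_measurable_fun => x; apply: cvgM; [exact: cX | exact: cpdf].
Qed.

Lemma cvg_boundary_term k :
  n%:R ^+ k.*2.+1 * pdf n%:R @[n --> \oo] --> (0 : R).
Proof.
(* From [expR y >= y ^ (k+1) / (k+1)!] at [y = n ^ 2 / 2]: the boundary term is
   at most a constant over [n]. *)
pose C : R := normal_peak 1 * (k.+1`!%:R * 2 ^+ k.+1).
apply: (@squeeze_cvgr _ _ _ _ (cst 0) (fun n : nat => C * n%:R^-1)); last 2 first.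
- exact: cvg_cst.
- rewrite -(mulr0 C); apply: cvgM; first exact: cvg_cst.
  by rewrite -(cvg_shiftS (fun n : nat => n%:R^-1 : R)); exact: cvg_harmonic.
near=> n.
have n0 : (0 < n)%N by near: n; exact: nbhs_infty_gt.
have n0' : (0 : R) < n%:R by rewrite ltr0n.
rewrite mulr_ge0 ?normal_pdf_ge0 ?exprn_ge0 //= normal_pdf01E /C.
rewrite mulrCA -!mulrA ler_pM2l ?normal_peak_gt0 ?oner_neq0 //.
rewrite mulNr expRN ler_pdivrMr ?expR_gt0 //.
have e := @expR_ge1Dxn R (n%:R ^+ 2 / 2) k (divr_ge0 (sqr_ge0 _) (ler0n R 2)).
have {}e : (n%:R ^+ 2 / 2) ^+ k.+1 / k.+1`!%:R <= expR (n%:R ^+ 2 / 2) :> R.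
  by apply: le_trans e; rewrite lerDr.
have f0 : (k.+1`!%:R : R) != 0 by rewrite pnatr_eq0 -lt0n fact_gt0.
have -> : n%:R ^+ k.*2.+1 =
    k.+1`!%:R * (2 ^+ k.+1 * n%:R^-1) * ((n%:R ^+ 2 / 2) ^+ k.+1 / k.+1`!%:R) :> R.
  have -> : n%:R ^+ k.*2.+1 = (n%:R ^+ 2) ^+ k.+1 / n%:R :> R.
    by rewrite -exprM mul2n doubleS [in RHS]exprSr mulfK // gt_eqF.
  rewrite expr_div_n; field.
  by rewrite f0 expf_neq0 ?pnatr_eq0 // -lt0n.
by rewrite ler_wpM2l // !mulr_ge0 // ?invr_ge0 ?exprn_ge0.
Unshelve. all: by end_near. Qed.

Definition half_moment k := (\int[mu]_(x in `[0%R, +oo[) (x ^+ k.*2 * pdf x)%R%:E)%E.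

Lemma continuous_moment_integrand k : continuous (fun x : R => x ^+ k.*2 * pdf x).
Proof.
by move=> x; apply: cvgM; [exact: exprn_continuous | exact: continuous_normal_pdf01].
Qed.

Lemma moment_integrand_ge0 k x : 0 <= x ^+ k.*2 * pdf x.
Proof.
by rewrite mulr_ge0 ?normal_pdf_ge0 // exprn_even_ge0 // odd_double.
Qed.

Lemma half_momentS k r : half_moment k = r%:E ->
  half_moment k.+1 = (k.*2.+1%:R * r)%:E.
Proof.
move=> kr.
have cvgJ j : (\int[mu]_(x in `[0%R, n%:R]) (x ^+ j.*2 * pdf x)%R%:E)%E @[n --> \oo]
    --> half_moment j.
  apply: (@ge0_cvgn_integral _ mu (fun x => x ^+ j.*2 * pdf x)).
    exact: moment_integrand_ge0.
  by apply: continuous_measurable_fun; exact: continuous_moment_integrand.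
have c1 := cvgJ k.+1.
suff c2 : (\int[mu]_(x in `[0%R, n%:R]) (x ^+ k.+1.*2 * pdf x)%R%:E)%E @[n --> \oo]
    --> (k.*2.+1%:R * r)%:E.
  by rewrite -(cvg_lim _ c1) // (cvg_lim _ c2).
have : ((- (n%:R ^+ k.*2.+1 * pdf n%:R))%:E + k.*2.+1%:R%:E *
    \int[mu]_(x in `[0%R, n%:R]) (x ^+ k.*2 * pdf x)%R%:E)%E @[n --> \oo] -->
    (0%:E + k.*2.+1%:R%:E * r%:E)%E.
  have h : - (n%:R ^+ k.*2.+1 * pdf n%:R) @[n --> \oo] --> (0 : R).
    by have := cvgN (@cvg_boundary_term k) => /(_ _); rewrite oppr0; apply.
  apply: cvgeD => //.
    apply: cvg_EFin; first by near=> n.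
    exact: h.
  by apply: cvgeZl => //; rewrite -kr; exact: cvgJ.
rewrite add0e -EFinM; apply: cvg_trans; apply: near_eq_cvg.
near=> n; rewrite moment_by_parts //; near: n; exact: nbhs_infty_gt.
Unshelve. all: by end_near. Qed.

Lemma half_moment0 : half_moment 0 = 2^-1%:E.
Proof.
have H := @ge0_symfun_integralT R pdf (normal_pdf_ge0 0 1)
  continuous_normal_pdf01.
have {}H : (1 = 2%:E * half_moment 0)%E.
  rewrite -(integral_normal_pdf (0:R) 1) H.
    rewrite /half_moment set_itvcy; congr (_ * _)%E.
    by apply: eq_integral => x _; rewrite expr0 mul1r.
  by move=> x; rewrite normal_pdf01E /= sqrrN.
have : (2^-1%:E * 1 = 2^-1%:E * (2%:E * half_moment 0) :> \bar R)%E by rewrite -H.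
by rewrite mule1 muleA -EFinM mulVf // mul1e.
Qed.

Lemma half_momentE k : half_moment k = (2^-1 * (gaussian_moment k.*2)%:R)%:E.
Proof.
elim: k => [|k IH]; first by rewrite half_moment0 mulr1.
by rewrite (half_momentS IH) mulrCA -natrM.
Qed.

Lemma integral_moment_pdf k :
  (\int[mu]_x (x ^+ k.*2 * pdf x)%R%:E = (gaussian_moment k.*2)%:R%:E)%E.
Proof.
rewrite ge0_symfun_integralT.
- by rewrite -set_itvcy -/(half_moment k) half_momentE -EFinM mulrA mulfV // mul1r.
- exact: moment_integrand_ge0.
- exact: continuous_moment_integrand.
- move=> x /=; rewrite normal_pdf01E sqrrN exprNn -signr_odd odd_double expr0.
  by rewrite mul1r.
Qed.

Lemma ge0_integral_normal_prob (f : R -> R) :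
  measurable_fun [set: R] f -> (forall x, 0 <= f x) ->
  (\int[normal_prob 0 1]_x (f x)%:E = \int[mu]_x (f x * pdf x)%:E)%E.
Proof.
move=> mf f0; transitivity (\int[normal_prob 0 1]_x (f x * cst (1 : R) x)%:E)%E.
  by apply: eq_integral => x _; rewrite mulr1.
apply: (@eq_integral_density _ _ _ _ _ _ _ (normal_prob (0:R) 1) mu idfun idfun
  (cst 1) pdf f) => //.
- exact: measurable_id.
- exact: measurable_id.
- exact: measurable_normal_pdf.
- exact: normal_pdf_ge0.
- move=> A mA; transitivity (normal_prob (0:R) 1 A).
    under eq_integral do rewrite mulr1.
    by rewrite integral_indic // classical_sets.setIT.
  rewrite /normal_prob [LHS]integral_mkcond; apply: eq_integral => x _ /=.
  rewrite patchE indicE; case: ifP => _; [by rewrite mul1r|by rewrite mul0r].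
Qed.

Lemma normal_prob_even_moment k :
  (\int[normal_prob 0 1]_x (x ^+ k.*2)%R%:E = (gaussian_moment k.*2)%:R%:E :> \bar R)%E.
Proof.
rewrite ge0_integral_normal_prob ?integral_moment_pdf //.
by move=> x; rewrite exprn_even_ge0 // odd_double.
Qed.

End GaussianMoments.

(** * Moments of symmetric and of Gaussian random variables *)

Section RandomVariableMoments.
Local Open Scope classical_set_scope.
Local Open Scope ring_scope.
Context {d : measure_display} {T : measurableType d} {R : realType}.
Variable P : probability T R.
Notation mu := (@lebesgue_measure R).

Lemma measurable_exprn (k : nat) : measurable_fun [set: R] (fun x : R => x ^+ k).
Proof. by apply: measurable_funX. Qed.

Lemma measurable_RV_exprn (X : {RV P >-> R}) k :
  measurable_fun [set: T] (fun w => X w ^+ k).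
Proof. by apply: measurable_funX. Qed.

Lemma ge0_integral_symmetric (X : {RV P >-> R}) (f : R -> R) :
  symmetrically_distributed X ->
  measurable_fun [set: R] f -> (forall x, 0 <= f x) ->
  (\int[P]_w (f (X w))%:E = \int[P]_w (f (- X w))%:E)%E.
Proof.
move=> sX mf f0.
transitivity (\int[P]_w (f (X w) * cst (1 : R) w)%:E)%E.
  by apply: eq_integral => w _; rewrite mulr1.
transitivity (\int[P]_w (f (- X w) * cst (1 : R) w)%:E)%E; last first.
  by apply: eq_integral => w _; rewrite mulr1.
have mN : measurable_fun [set: T] (fun w => - X w) by exact: measurableT_comp.
apply: (@eq_integral_density _ _ _ _ _ _ _ P P X (fun w => - X w) (cst 1) (cst 1)) => //.
move=> A mA; have E : P (X @^-1` A) = P ((fun w => - X w) @^-1` A) by exact: sX.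
have mXA : measurable (X @^-1` A).
  by rewrite -[X in measurable X]setTI; apply: measurable_funP.
have mNA : measurable ((fun w => - X w) @^-1` A).
  by rewrite -[X in measurable X]setTI; apply: mN.
transitivity (\int[P]_w (\1_(X @^-1` A) w)%:E)%E.
  by apply: eq_integral => w _; rewrite mulr1.
transitivity (\int[P]_w (\1_((fun w => - X w) @^-1` A) w)%:E)%E; last first.
  by apply: eq_integral => w _; rewrite mulr1.
by rewrite !integral_indic // !classical_sets.setIT.
Qed.

(** Since [|x|^k <= 1 + x^(2k)], control of the even moments suffices. *)
Lemma integrable_moment (X : {RV P >-> R}) (k : nat) :
  (\int[P]_w (X w ^+ k.*2)%:E < +oo)%E ->
  P.-integrable [set: T] (fun w => (X w ^+ k)%:E).
Proof.
move=> fin.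
apply: (@le_integrable _ _ _ P _ measurableT _ (fun w => (1 + X w ^+ k.*2)%:E)).
- by apply/measurable_EFinP; exact: measurable_RV_exprn.
- move=> w _; rewrite !abse_EFin lee_fin.
  have x0 : 0 <= X w ^+ k.*2 by rewrite exprn_even_ge0 // odd_double.
  rewrite [leRHS]ger0_norm ?addr_ge0 // normrX.
  have -> : X w ^+ k.*2 = (`|X w| ^+ k) ^+ 2.
    by rewrite -normrX real_normK ?num_real // -exprM muln2.
  move: (`|X w| ^+ k) => y.
  have := sqr_ge0 (y - 1); have := sqr_ge0 (y + 1); nra.
- under eq_fun do rewrite EFinD.
  apply: integrableD => //; first exact: finite_measure_integrable_cst.
  apply/integrableP; split.
    by apply/measurable_EFinP; exact: measurable_RV_exprn.
  under eq_integral => w _ do rewrite abse_EFin ger0_norm ?exprn_even_ge0 ?odd_double //.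
  exact: fin.
Qed.

(** Replacing [X] by [- X] exchanges the positive and negative parts of an odd
    power. *)
Lemma odd_moment_eq0 (X : {RV P >-> R}) (k : nat) :
  symmetrically_distributed X -> odd k ->
  P.-integrable [set: T] (fun w => (X w ^+ k)%:E) ->
  (\int[P]_w (X w ^+ k)%:E = 0)%E.
Proof.
move=> sX ok iX.
pose f w := X w ^+ k.
transitivity (\int[P]_w ((f^\+ w)%:E - (f^\- w)%:E))%E.
  apply: eq_integral => w _; rewrite -EFinB.
  by rewrite -[in LHS]/(f w) -[in LHS](funrposBneg f).
have ip := integrable_funrpos measurableT iX.
have im := integrable_funrneg measurableT iX.
rewrite integralB //.
have -> : (\int[P]_w (f^\- w)%:E = \int[P]_w (f^\+ w)%:E)%E.
  rewrite [RHS](@ge0_integral_symmetric X (fun x => Num.max (x ^+ k) 0)) //.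
  - apply: eq_integral => w _; rewrite /funrneg.
    by rewrite exprNn -signr_odd ok expr1 mulN1r.
  - by apply: measurable_maxr => //; exact: measurable_exprn.
  by move=> x; rewrite le_max lexx orbT.
by rewrite subee // integrable_fin_num.
Qed.

Lemma normal_prob01_opp (A : set R) : measurable A ->
  normal_prob 0 1 (-%R @^-1` A) = normal_prob (0 : R) 1 A.
Proof.
move=> mA; pose pdf := @normal_pdf R 0 1.
have mpdf : measurable_fun [set: R] pdf by exact: measurable_normal_pdf.
have indE (B : set R) : normal_prob 0 1 B = (\int[mu]_x (\1_B x * pdf x)%:E)%E.
  rewrite /normal_prob [LHS]integral_mkcond; apply: eq_integral => x _ /=.
  by rewrite patchE indicE; case: ifP => _; rewrite ?mul1r ?mul0r.
rewrite !indE.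
have mN : measurable_fun [set: R] (-%R : R -> R) by exact: oppr_measurable.
transitivity (\int[mu]_x ((\1_A (- x) * pdf (- x)) * cst (1 : R) x)%:E)%E.
  apply: eq_integral => x _; rewrite mulr1; congr (_ * _)%:E.
  by rewrite /pdf normal_pdf01E sqrrN.
transitivity (\int[mu]_x ((\1_A x * pdf x) * cst (1 : R) x)%:E)%E; last first.
  by apply: eq_integral => x _; rewrite mulr1.
apply: (@eq_integral_density _ _ _ _ _ _ _ mu mu -%R idfun
  (cst 1) (cst 1) (fun x => \1_A x * pdf x)) => //.
- exact: measurable_id.
- move=> B mB.
  transitivity (\int[mu]_x (\1_(-%R @^-1` B) x)%:E)%E.
    by apply: eq_integral => x _; rewrite mulr1.
  transitivity (\int[mu]_x (\1_B x)%:E)%E; last first.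
    by apply: eq_integral => x _; rewrite mulr1.
  have mNB : measurable (-%R @^-1` B).
    by rewrite -[X in measurable X]setTI; apply: mN.
  rewrite !integral_indic // !classical_sets.setIT.
  exact: lebesgue_measureN.
- by apply: measurable_funM => //; exact: measurable_indic.
- by move=> x; rewrite mulr_ge0 ?normal_pdf_ge0.
Qed.

Lemma standard_gaussian_symmetric (X : {RV P >-> R}) :
  standard_gaussian X -> symmetrically_distributed X.
Proof.
move=> gX A mA; rewrite gX // -normal_prob01_opp // -gX //.
rewrite -[X in measurable X]setTI.
by apply: (@oppr_measurable R [set: R]).
Qed.

Lemma standard_gaussian_even_moment (X : {RV P >-> R}) k :
  standard_gaussian X ->
  (\int[P]_w (X w ^+ k.*2)%:E = (gaussian_moment k.*2)%:R%:E)%E.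
Proof.
move=> gX; rewrite -normal_prob_even_moment.
have x0 (x : R) : 0 <= x ^+ k.*2 by rewrite exprn_even_ge0 // odd_double.
transitivity (\int[P]_w (X w ^+ k.*2 * cst (1 : R) w)%:E)%E.
  by apply: eq_integral => w _; rewrite mulr1.
transitivity (\int[normal_prob 0 1]_x ((x : R) ^+ k.*2 * cst (1 : R) x)%:E)%E; last first.
  by apply: eq_integral => x _; rewrite mulr1.
apply: (@eq_integral_density _ _ _ _ _ _ _ P (normal_prob (0 : R) 1) X idfun
  (cst 1) (cst 1) (fun x => x ^+ k.*2)) => //.
- exact: measurable_id.
- move=> A mA; transitivity (\int[P]_w (\1_A (X w))%:E)%E.
    by apply: eq_integral => w _; rewrite mulr1.
  rewrite integral_indic_preimage //.
  transitivity (\int[normal_prob (0 : R) 1]_x (\1_A x)%:E)%E; last first.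
    by apply: eq_integral => x _; rewrite mulr1.
  rewrite integral_indic // classical_sets.setIT; exact: gX.
Qed.

Lemma standard_gaussian_moment (X : {RV P >-> R}) k :
  standard_gaussian X ->
  P.-integrable [set: T] (fun w => (X w ^+ k)%:E) /\
  (\int[P]_w (X w ^+ k)%:E = (gaussian_moment k)%:R%:E)%E.
Proof.
move=> gX.
have iX : P.-integrable [set: T] (fun w => (X w ^+ k)%:E).
  by apply: integrable_moment; rewrite standard_gaussian_even_moment // ltry.
split=> //; case: (boolP (odd k)) => ok.
  rewrite odd_moment_eq0 // ?gaussian_moment_odd //.
  exact: standard_gaussian_symmetric.
by rewrite -(even_halfK ok) standard_gaussian_even_moment.
Qed.

(** The hypothesis only bounds the even moments; the odd ones vanish, which also
    yields the nonnegativity needed to multiply such bounds. *)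
Lemma subgaussian_moment (X : {RV P >-> R}) k :
  symmetrically_distributed X ->
  (forall p : nat, ('E_P[(fun w => (X w) ^+ (2 * p))%R] <=
     'E_(normal_prob 0 1)[(fun x : R => x ^+ (2 * p))%R])%E) ->
  exists a : R, [/\ P.-integrable [set: T] (fun w => (X w ^+ k)%:E),
    (\int[P]_w (X w ^+ k)%:E = a%:E)%E & 0 <= a <= (gaussian_moment k)%:R].
Proof.
move=> sX mX.
have even_le p : (\int[P]_w (X w ^+ p.*2)%:E <= (gaussian_moment p.*2)%:R%:E)%E.
  by have := mX p; rewrite unlock mul2n -normal_prob_even_moment.
have iX : P.-integrable [set: T] (fun w => (X w ^+ k)%:E).
  by apply: integrable_moment; rewrite (le_lt_trans (even_le k)) // ltry.
exists (fine (\int[P]_w (X w ^+ k)%:E)); split => //.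
  by rewrite fineK // integrable_fin_num.
case: (boolP (odd k)) => ok.
  by rewrite odd_moment_eq0 // lexx ler0n.
rewrite -2!lee_fin fineK ?integrable_fin_num // -(even_halfK ok) even_le andbT.
by apply: integral_ge0 => w _; rewrite lee_fin exprn_even_ge0 // odd_double.
Qed.

End RandomVariableMoments.

(** * Expansion of the normalized moments *)

Section MomentExpansion.
Local Open Scope classical_set_scope.
Local Open Scope ring_scope.

Lemma prod_exp_count (R : comPzRingType) (E : finType) (l : nat -> E) (F : E -> R)
    (r : seq nat) :
  \prod_(t <- r) F (l t) = \prod_e F e ^+ count (fun t => l t == e) r.
Proof.
elim: r => [|t r IH]; first by rewrite big_nil big1.
rewrite big_cons IH /=; under [RHS]eq_bigr do rewrite exprD.
rewrite big_split; congr (_ * _).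
rewrite (bigD1 (l t)) //= eqxx expr1 big1 ?mulr1 //.
by move=> e; rewrite eq_sym => /negbTE ->.
Qed.

Context {d : measure_display} {T : measurableType d} {R : realType}.
Variable P : probability T R.

Lemma normalized_moment0 n m (X : T -> 'M[R]_(n.+1, m)) :
  normalized_moment P X 0 = 1%E.
Proof.
rewrite /normalized_moment -[RHS](expectation_cst P 1); congr (expectation P _).
apply/funext => w; rewrite /normalized_trace /= expr0.
by rewrite [\tr _]mxtrace1 mulVf // pnatr_eq0.
Qed.

(** The factors of the product along a walk are grouped by matrix entry, which
    makes them independent. *)
Lemma normalized_momentE n m p (X : T -> 'M[R]_(n.+1, m.+1))
    (b : 'M[R]_(n.+1, m.+1)) (xi : 'I_n.+1 -> 'I_m.+1 -> {RV P >-> R})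
    (a : 'I_n.+1 * 'I_m.+1 -> nat -> R) :
  (0 < p)%N -> (forall w i j, X w i j = b i j * xi i j w) ->
  mutually_independent (fun ij : 'I_n.+1 * 'I_m.+1 => xi ij.1 ij.2) ->
  (forall e k, P.-integrable [set: T] (fun w => (xi e.1 e.2 w ^+ k)%:E)) ->
  (forall e k, \int[P]_w (xi e.1 e.2 w ^+ k)%:E = (a e k)%:E)%E ->
  normalized_moment P X p = (n.+1%:R^-1 *
    \sum_(s <- words n.+1 m.+1 p.*2)
      (\prod_(t <- iota 0 p.*2)
         b (entry_index n m p.*2 s t).1 (entry_index n m p.*2 s t).2) *
      \prod_e a e (count (fun t => entry_index n m p.*2 s t == e) (iota 0 p.*2)))%:E.
Proof.
move=> p0 XE indep ixi axi; rewrite /normalized_moment unlock.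
pose N s e := count (fun t => entry_index n m p.*2 s t == e) (iota 0 p.*2).
pose B s := \prod_(t <- iota 0 p.*2)
         b (entry_index n m p.*2 s t).1 (entry_index n m p.*2 s t).2.
have trE w : \tr ((X w *m (X w)^T) ^+ p) =
    \sum_(s <- words n.+1 m.+1 p.*2) B s * \prod_e xi e.1 e.2 w ^+ N s e.
  rewrite trace_gram_power //; apply: eq_bigr => s _.
  under eq_bigr do rewrite XE.
  rewrite big_split; congr (_ * _).
  exact: (prod_exp_count (entry_index n m p.*2 s) (fun e => xi e.1 e.2 w)).
have H s := @integral_prod_indep _ _ _ P _ _ indep (fun e x => x ^+ N s e)
  (fun e => a e (N s e)) (fun e => measurable_exprn _) (fun e => ixi e _)
  (fun e => axi e _).
have iS s : P.-integrable [set: T]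
    (fun w => (B s)%:E * (\prod_e xi e.1 e.2 w ^+ N s e)%:E)%E.
  by apply: integrableZl => //; case: (H s).
transitivity (\int[P]_w (n.+1%:R^-1%:E * \sum_(s <- words n.+1 m.+1 p.*2)
    ((B s)%:E * (\prod_e xi e.1 e.2 w ^+ N s e)%:E)))%E.
  apply: eq_integral => w _; rewrite /normalized_trace trE EFinM -sumEFin.
  by congr (_ * _)%E; apply: eq_bigr => s _; rewrite EFinM.
rewrite integralZl //; last exact: integrable_sum.
rewrite integral_sum // EFinM -sumEFin; congr (_ * _)%E; apply: eq_bigr => s _.
by case: (H s) => iH eH; rewrite integralZl // eH -EFinM.
Qed.

End MomentExpansion.

(** * The extremal matrix *)

Section SparseClass.
Local Open Scope classical_set_scope.
Local Open Scope ring_scope.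
Variable R : realType.

Lemma bigmax2_eq1 n m (F : 'I_n -> 'I_m -> R) :
  \big[Num.max/0]_(i < n) \big[Num.max/0]_(j < m) F i j = 1 ->
  [/\ (0 < n)%N, (0 < m)%N & forall i j, F i j <= 1].
Proof.
move=> e; split.
- case: n F e => // F; rewrite big_ord0 => /eqP.
  by rewrite eq_sym oner_eq0.
- case: m F e => // F e; suff : (1 : R) <= 0 by rewrite ler10.
  rewrite -e; apply: bigmax_le => // i _.
  by rewrite big_ord0.
- move=> i j; rewrite -e.
  apply: le_trans (le_bigmax _ (fun i => \big[Num.max/0]_(j < m) F i j) i).
  exact: (le_bigmax _ (F i)).
Qed.

Lemma bigmax_const n (c : R) : 0 <= c -> (0 < n)%N ->
  \big[Num.max/0]_(i < n) c = c.
Proof.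
case: n => // n c0 _; apply/eqP; rewrite eq_le; apply/andP; split.
  exact: bigmax_le.
exact: (le_bigmax _ (fun=> c) (ord0 : 'I_n.+1)).
Qed.

End SparseClass.

Local Open Scope ring_scope.

Theorem corollary1p8 (R : realType) (d1 d2 : nat)
    (d1_gt0 : (0 < d1)%N) (d2_gt0 : (0 < d2)%N)
    (dY : measure_display) (TY : measurableType dY) (PY : probability TY R)
    (Y : TY -> 'M[R]_(d1, d2)) (hY : iid_standard_gaussian_matrix PY Y) :
  sparse_class PY d1 d2 Y /\
  forall (dX : measure_display) (TX : measurableType dX)
         (PX : probability TX R) (n m : nat) (X : TX -> 'M[R]_(n, m)),
    sparse_class PX d1 d2 X ->
    forall p : nat,
      (normalized_moment PX X p <= normalized_moment PY Y p)%E.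
Proof.
case: hY => g [Yg gindep ggauss]; split.
  exists (const_mx 1), g; split; split.
  - by move=> w i j; rewrite mxE mul1r.
  - by move=> i j; rewrite mxE.
  - exact: gindep.
  - by move=> i j; exact: standard_gaussian_symmetric.
  - move=> i j p; rewrite unlock mul2n standard_gaussian_even_moment //.
    by rewrite normal_prob_even_moment.
  - under eq_bigr do under eq_bigr do rewrite mxE expr1n.
    by under eq_bigr do rewrite bigmax_const //; rewrite bigmax_const.
  - under eq_bigr do under eq_bigr do rewrite mxE expr1n.
    under eq_bigr do rewrite sumr_const card_ord.
    by rewrite bigmax_const.
  - under eq_bigr do under eq_bigr do rewrite mxE expr1n.
    under eq_bigr do rewrite sumr_const card_ord.
    by rewrite bigmax_const.
move=> dX TX PX n m X [b [xi [[Xb b0 xindep xsym xmom] [bmax bcol brow]]]] p.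
have [n0 m0 b1] := bigmax2_eq1 bmax.
case: d1 d1_gt0 Y g Yg gindep ggauss bcol => // d1 _ Y g Yg gindep ggauss bcol.
case: d2 d2_gt0 Y g Yg gindep ggauss brow => // d2 _ Y g Yg gindep ggauss brow.
case: n n0 X b xi Xb b0 xindep xsym xmom bmax bcol brow b1 => // n _ X.
case: m m0 X => // m _ X b xi Xb b0 xindep xsym xmom _ bcol brow b1.
have [->|p0] := posnP p; first by rewrite !normalized_moment0.
have /choice [a ha] : forall e : 'I_n.+1 * 'I_m.+1, exists ae : nat -> R, forall k,
    [/\ PX.-integrable [set: TX]%classic (fun w => (xi e.1 e.2 w ^+ k)%:E),
     (\int[PX]_w (xi e.1 e.2 w ^+ k)%:E = (ae k)%:E)%E &
      0 <= ae k <= (gaussian_moment k)%:R].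
  move=> e; suff /choice [ae hae] : forall k, exists c : R,
      [/\ PX.-integrable [set: TX]%classic (fun w => (xi e.1 e.2 w ^+ k)%:E),
       (\int[PX]_w (xi e.1 e.2 w ^+ k)%:E = c%:E)%E &
       0 <= c <= (gaussian_moment k)%:R] by exists ae.
  by move=> k; exact: subgaussian_moment.
rewrite (@normalized_momentE _ _ _ _ _ _ _ _ b xi a) //; last 2 first.
- by move=> e k; case: (ha e k).
- by move=> e k; case: (ha e k).
rewrite (@normalized_momentE _ _ _ _ _ _ _ _ (const_mx 1) g
  (fun _ k => (gaussian_moment k)%:R)) //; last 3 first.
- by move=> w i j; rewrite mxE mul1r.
- by move=> e k; case: (standard_gaussian_moment k (ggauss e.1 e.2)).
- by move=> e k; case: (standard_gaussian_moment k (ggauss e.1 e.2)).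
rewrite lee_fin ler_pdivrMl ?ltr0n // mulrCA ler_pdivlMl ?ltr0n //.
(* The coefficients of [b] indexed by numbers; out of range [inord] falls back
   on the first index, which keeps [beta] between [0] and [1]. *)
pose beta i j : R := b (inord i) (inord j).
have beta01 i j : 0 <= beta i j <= 1.
  by rewrite /beta b0 /= -(@expr_le1 _ 2) // b1.
apply: le_trans (_ : _ <= d1.+1%:R * (\sum_(s <- words n.+1 m.+1 p.*2)
    (\prod_(t <- iota 0 p.*2) beta (edge p.*2 s t).1 (edge p.*2 s t).2) *
    (gaussian_weight n m p s)%:R)) _.
  rewrite ler_wpM2l //; apply: ler_sum => s _; rewrite ler_wpM2l //.
    by apply: prodr_ge0.
  rewrite natr_prod; apply: ler_prod => e _.
  by case: (ha e (count (fun t => entry_index n m p.*2 s t == e) (iota 0 p.*2))).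
apply: le_trans (gaussian_domination (d1 := d1) (d2 := d2) p0 beta01 _ _) _.
- move=> c cm; rewrite sum_iota_ord.
  apply: le_trans bcol.
  apply: le_trans (le_bigmax _ (fun j => \sum_(i < n.+1) b i j ^+ 2) (inord c)).
  by apply: ler_sum => i _; rewrite /beta inord_val.
- move=> c cm; rewrite sum_iota_ord.
  apply: le_trans brow.
  apply: le_trans (le_bigmax _ (fun i => \sum_(j < m.+1) b i j ^+ 2) (inord c)).
  by apply: ler_sum => i _; rewrite /beta inord_val.
rewrite ler_wpM2l //; apply: ler_sum => s _.
rewrite big1 ?mul1r ?natr_prod // => t _.
by rewrite mxE.
Qed.
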